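(* Let $\Upsilon$ denote any one of the Menger, Hurewicz or Rothberger properties. Let $\{X_\alpha:\alpha\in\Lambda\}$ be a locally finite family of closed subspaces of a uniform space $(X,\mathbb{U})$ satisfying $X=\bigcup_{\alpha\in\Lambda}X_\alpha$. Then $X$ is locally $\Upsilon$-bounded if and only if each $X_\alpha$ is locally $\Upsilon$-bounded.
   Context: A uniformity on a set $X$ is a nonempty family $\mathbb{U}$ of symmetric subsets of $X\times X$ containing the diagonal $\Delta=\{(x,x):x\in X\}$ (entourages) such that: (i) if $U\in\mathbb{U}$ and $V\supseteq U$ is a symmetric subset of $X\times X$, then $V\in\mathbb{U}$; (ii) $U,V\in\mathbb{U}$ implies $U\cap V\in\mathbb{U}$; (iii) for every $U\in\mathbb{U}$ there is $V\in\mathbb{U}$ with $V\circ V\subseteq U$; (iv) $\bigcap\mathbb{U}=\Delta$. The pair $(X,\mathbb{U})$ is a uniform space. For $U\in\mathbb{U}$, $x\in X$, $F\subseteq X$: $U[x]=\{y\in X:(x,y)\in U\}$ and $U[F]=\bigcup_{x\in F}U[x]$. Topological notions (closed, locally finite) refer to the topology in which $O\subseteq X$ is open iff for each $x\in O$ there is $U\in\mathbb{U}$ with $U[x]\subseteq O$. A subset $Y\subseteq X$ is a subspace with the relative uniformity $\mathbb{U}_Y=\{(Y\times Y)\cap U:U\in\mathbb{U}\}$. A uniform space $(X,\mathbb{U})$ is: ${\sf M}$-bounded (the case $\Upsilon$ = Menger) if for each sequence $(U_n)_{n\in\mathbb{N}}$ in $\mathbb{U}$ there are finite $F_n\subseteq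 X$ with $\bigcup_nU_n[F_n]=X$; ${\sf H}$-bounded ($\Upsilon$ = Hurewicz) if for each sequence $(U_n)$ in $\mathbb{U}$ there are finite $F_n\subseteq X$ such that each $x\in X$ belongs to $U_n[F_n]$ for all but finitely many $n$; ${\sf R}$-bounded ($\Upsilon$ = Rothberger) if for each sequence $(U_n)$ in $\mathbb{U}$ there are $x_n\in X$ with $\bigcup_nU_n[x_n]=X$. ''$\Upsilon$-bounded'' denotes the corresponding one of these properties. $X$ is locally $\Upsilon$-bounded if for each $x\in X$ there is $U\in\mathbb{U}$ such that $U[x]$ is a $\Upsilon$-bounded subspace of $X$. *)

(* Defs.v *)
From mathcomp Require Import all_boot all_classical topology.

Set Implicit Arguments.
Unset Strict Implicit.
Unset Printing Implicit Defensive.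

Local Open Scope classical_set_scope.
Local Open Scope relation_scope.

(* A [uniformType] carries the filter of all entourages, symmetric or not, and
   need not be separated. The uniformities considered here consist of symmetric
   entourages and are separated: they are the families [@sym_entourage X] for
   [X : uniformType] with [separated_uniformity X]. *)
Definition sym_entourage (X : uniformType) : set_system (X * X) :=
  [set U | entourage U /\ U^-1 = U].

Definition separated_uniformity (X : uniformType) : Prop :=
  \bigcap_(U in @sym_entourage X) U = diagonal.

(* [xsection U x] is U[x]; this is U[F]. *)
Definition ent_image (X : Type) (U : set (X * X)) (F : set X) : set X :=
  \bigcup_(x in F) xsection U x.

Definition M_bounded (X : uniformType) : Prop :=
  forall U : nat -> set (X * X), (forall n, sym_entourage (U n)) ->
  exists F : nat -> set X,
    (forall n, finite_set (F n)) /\ \bigcup_n ent_image (U n) (F n) = setT.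

Definition H_bounded (X : uniformType) : Prop :=
  forall U : nat -> set (X * X), (forall n, sym_entourage (U n)) ->
  exists F : nat -> set X,
    (forall n, finite_set (F n)) /\
    forall x : X, finite_set [set n | ~ ent_image (U n) (F n) x].

Definition R_bounded (X : uniformType) : Prop :=
  forall U : nat -> set (X * X), (forall n, sym_entourage (U n)) ->
  exists x : nat -> X, \bigcup_n xsection (U n) (x n) = setT.

Variant selection_property := Menger | Hurewicz | Rothberger.

Definition bounded_space (P : selection_property) (X : uniformType) : Prop :=
  match P with
  | Menger => M_bounded X
  | Hurewicz => H_bounded X
  | Rothberger => R_bounded X
  end.

(* A subset [A : set X], seen as a subspace, is the type [set_type A] with the
   uniform structure induced by its inclusion in [X]. *)
Definition locally_bounded (P : selection_property) (X : uniformType) : Prop :=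
  forall x : X, exists U : set (X * X),
    sym_entourage U /\ bounded_space P (set_type (xsection U x)).

Definition locally_finite (I : Type) (X : topologicalType) (A : I -> set X) :
    Prop :=
  forall x : X, exists V : set X,
    nbhs x V /\ finite_set [set i | A i `&` V !=set0].

(* Main.v *)
(* Boundedness of a subspace [S] of [X] can be tested with the entourages of
   [X] and with centres anywhere in [X] (halve the entourages to move the
   centres into [S]).  In this form it passes to subsets and to finite unions,
   and it does not depend on the space in which [S] is embedded.  Restricting
   an entourage to [A a] gives one direction.  For the other, closedness and
   local finiteness show that a small neighbourhood of [x] meets only the
   finitely many [A a] containing [x], each in a bounded set. *)
Require Import Defs.
From mathcomp Require Import all_boot all_classical topology.

Local Open Scope classical_set_scope.

(** Together with [often], this lets one formula express all three properties: [small] limits the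
    set of centres, [often] says at how many indices a point has to be covered. *)
Definition small (P : selection_property) (T : Type) (F : set T) : Prop :=
  if P is Rothberger then is_subset1 F else finite_set F.

Definition often (P : selection_property) (D : set nat) : Prop :=
  if P is Hurewicz then finite_set (~` D) else D !=set0.

(* For [Rothberger] the [F n] are allowed to be empty, so that, unlike the
   space [set_type set0], the subset [set0] is bounded. *)
Definition bounded_in (P : selection_property) (X : uniformType) (S : set X) :
    Prop :=
  forall U : nat -> set (X * X), (forall n, entourage (U n)) ->
  exists F : nat -> set X, (forall n, small P X (F n)) /\
    forall x, S x -> often P [set n | ent_image (U n) (F n) x].

Definition pair_preimage {Y X : Type} (f : Y -> X) (V : set (X * X)) :
    set (Y * Y) :=
  [set p | V (f p.1, f p.2)].

(** Stated for maps rather than inclusions so that it composes: a neighbourhood inside [A a] is a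
    subspace of a subspace of [X]. *)
Definition induced_by (Y X : uniformType) (f : Y -> X) : Prop :=
  @entourage Y = filter_from (@entourage X) (pair_preimage f).

Lemma small_image (P : selection_property) (S T : Type) (f : S -> T)
  (F : set S) : small P S F -> small P T (f @` F).
Proof.
case: P => /=; [exact: finite_image | exact: finite_image |].
by move=> F1 _ _ [x Fx <-] [y Fy <-]; rewrite (F1 x y Fx Fy).
Qed.

Lemma sub_small (P : selection_property) (T : Type) (F G : set T) :
  F `<=` G -> small P T G -> small P T F.
Proof.
case: P => /= FG; [exact: sub_finite_set | exact: sub_finite_set |].
by move=> G1 x y /FG Gx /FG Gy; exact: G1.
Qed.

Lemma often_sub (P : selection_property) (D E : set nat) :
  D `<=` E -> often P D -> often P E.
Proof.
case: P => /= DE; last by case=> n /DE; exists n.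
- by case=> n /DE; exists n.
- by apply: sub_finite_set; exact: subsetC.
Qed.

Lemma ent_imageP (X : Type) (U : set (X * X)) (F : set X) (x : X) :
  ent_image U F x <-> exists2 z, F z & U (z, x).
Proof. by split=> -[z Fz /xsectionP Uzx]; exists z. Qed.

Lemma sym_entourageI (X : uniformType) (U : set (X * X)) :
  entourage U -> sym_entourage (U `&` U^-1)%relation.
Proof.
move=> entU; split; first exact: entourage_invI.
by apply/seteqP; split=> -[x y] [].
Qed.

(** Arbitrary entourages are replaced by their symmetric parts. The point [x0] is for Rothberger,
    where a centre must be named even if [F n] is empty. *)
Lemma bounded_spaceP (P : selection_property) (X : uniformType) (x0 : X) :
  bounded_space P X <-> bounded_in P X setT.
Proof.
split.
  move=> bX U entU.
  have symV n := sym_entourageI X (U n) (entU n).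
  have VU n F x : ent_image (U n `&` (U n)^-1)%relation F x ->
      ent_image (U n) F x.
    by move=> /ent_imageP[z Fz [Uzx _]]; apply/ent_imageP; exists z.
  case: P bX => /= /(_ _ symV).
  - move=> [F [finF FT]]; exists F; split=> // x _.
    by have : [set: X] x by []; rewrite -FT => -[n _ /VU]; exists n.
  - move=> [F [finF FT]]; exists F; split=> // x _.
    by apply: sub_finite_set (FT x) => n /= + /VU.
  - move=> [c cT]; exists (fun n => [set c n]); split.
      by move=> n x y -> ->.
    move=> x _; have : [set: X] x by [].
    rewrite -cT => -[n _ Vx]; exists n; apply: VU.
    by exists (c n).
move=> bX.
have {}bX U : (forall n, sym_entourage (U n)) -> exists F : nat -> set X,
    (forall n, small P X (F n)) /\
    forall x, often P [set n | ent_image (U n) (F n) x].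
  move=> symU; have [n|F [sF bF]] := bX U; first by have [] := symU n.
  by exists F; split=> // x; exact: bF.
case: P bX => /= bX U /bX[F [sF bF]].
- exists F; split=> //; apply/seteqP; split=> // x _.
  by have [n] := bF x; exists n.
- by exists F; split.
- exists (fun n => xget x0 (F n)); apply/seteqP; split=> // x _.
  have [n [z Fz Uzx]] := bF x; exists n => //.
  by rewrite (xget_subset1 _ Fz).
Qed.

(** Centres in [Y] are pushed forward by [f]; conversely, a centre [z] in [X] is traded for a point
    of [Y] with image close to [z], at the cost of halving the entourage. *)
Lemma bounded_in_range (P : selection_property) (Y X : uniformType)
  (f : Y -> X) : induced_by Y X f ->
  bounded_in P Y setT <-> bounded_in P X (range f).
Proof.
move=> entY; split=> [bY U entU|bX U entU].
  have entV n : entourage (pair_preimage f (U n)).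
    by rewrite entY; exists (U n).
  have [F [sF bF]] := bY _ entV; exists (fun n => f @` F n); split.
    by move=> n; exact: small_image.
  move=> _ [y _ <-]; apply: often_sub (bF y I) => n /ent_imageP[z Fz Uzy].
  by apply/ent_imageP; exists (f z) => //; exists z.
have /choice[V VP] n : exists V : set (X * X),
    entourage V /\ pair_preimage f V `<=` U n.
  by have := entU n; rewrite entY => -[V ? ?]; exists V.
(* Symmetric halves: two points [W n]-close to the same [z] are [V n]-close to each other. *)
pose W n := (split_ent (V n) `&` (split_ent (V n))^-1)%relation.
have entW n : entourage (W n).
  by apply: entourage_invI; apply: entourage_split_ent; have [] := VP n.
have [F [sF bF]] := bX W entW.
pose near_pt n z := [set y | W n (z, f y)].
(* An empty [Y] offers no default value for [xget], but also no point to cover. *)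
have [[y0 _]|Y0] := pselect (exists y0 : Y, True); last first.
  exists (fun=> set0); split; last by move=> y; case: Y0; exists y.
  by case: (P) => [n|n|n x y] //=; exact: finite_set0.
exists (fun n => (fun z => xget y0 (near_pt n z)) @` F n); split.
  by move=> n; exact: small_image.
move=> y _; apply: often_sub (bF (f y) (imageT f y)) => n.
move=> /ent_imageP[z Fz Wzy]; apply/ent_imageP.
exists (xget y0 (near_pt n z)); first by exists z.
(* The point [y] to be covered itself lies in [near_pt n z], so [xget] does not fall back on
   [y0]. *)
have [_ Wz] : near_pt n z (xget y0 (near_pt n z)).
  by apply: xgetPex; exists y.
have [entV VU] := VP n; apply: VU; apply: (entourage_split z) => //.
by have [] := Wzy.
Qed.

Lemma sub_bounded_in (P : selection_property) (X : uniformType)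
  (S T : set X) : S `<=` T -> bounded_in P X T -> bounded_in P X S.
Proof.
move=> ST bT U /bT[F [sF bF]]; exists F; split=> // x /ST; exact: bF.
Qed.

Lemma bounded_in0 (P : selection_property) (X : uniformType) :
  bounded_in P X set0.
Proof.
move=> U _; exists (fun=> set0); split=> // n.
by case: P => [||x y] //=; exact: finite_set0.
Qed.

(* Rothberger: cover [S] with the even-indexed entourages and [T] with the
   odd-indexed ones. *)
Lemma bounded_inU (P : selection_property) (X : uniformType) (S T : set X) :
  bounded_in P X S -> bounded_in P X T -> bounded_in P X (S `|` T).
Proof.
have [->|PR bS bT U entU] := pselect (P = Rothberger).
  move=> bS bT U entU.
  have [F [sF bF]] := bS (fun n => U n.*2) (fun n => entU _).
  have [G [sG bG]] := bT (fun n => U n.*2.+1) (fun n => entU _).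
  exists (fun n => if odd n then G n./2 else F n./2); split.
    by move=> n; case: ifP.
  move=> x [/bF|/bG] [n /= Ux]; [exists n.*2 | exists n.*2.+1] => /=.
    by rewrite odd_double doubleK.
  by rewrite odd_double uphalf_double.
(* Menger and Hurewicz: the union of two finite sets of centres is finite, so each index serves both
   [S] and [T]. *)
have [F [sF bF]] := bS U entU; have [G [sG bG]] := bT U entU.
exists (fun n => F n `|` G n); split.
  by move=> n; move: (sF n) (sG n); case: (P) PR => //= _ ? ?;
    rewrite finite_setU.
move=> x [/bF|/bG]; apply: often_sub => n /ent_imageP[z zF Uzx];
  apply/ent_imageP; exists z => //; by [left|right].
Qed.

Lemma range_set_val (T : Type) (A : set T) :
  range (set_val : set_type A -> T) = A.
Proof.
apply/seteqP; split=> [_ [x _ <-]|x Ax]; first exact: set_valP.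
by exists (SigSub (mem_set Ax)).
Qed.

Lemma set_type_induced (X : uniformType) (A : set X) :
  induced_by (set_type A) X set_val.
Proof. by []. Qed.

Lemma induced_comp (Z Y X : uniformType) (g : Z -> Y) (f : Y -> X) :
  induced_by Z Y g -> induced_by Y X f -> induced_by Z X (f \o g).
Proof.
move=> entZ entY; rewrite /induced_by entZ entY; apply/seteqP; split=> U.
  by move=> [V [W entW WV] VU]; exists W => // p Wp; apply: VU; exact: WV.
by move=> [W entW WU]; exists (pair_preimage f W) => //; exists W.
Qed.

Lemma bounded_set_type (P : selection_property) (Y X : uniformType)
  (f : Y -> X) (B : set Y) : induced_by Y X f -> B !=set0 ->
  bounded_space P (set_type B) <-> bounded_in P X (f @` B).
Proof.
move=> fi [y By].
have y0 : set_type B := SigSub (mem_set By).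
rewrite (bounded_spaceP _ (set_type B) y0).
rewrite (bounded_in_range _ _ X (f \o set_val)); last first.
  exact: (induced_comp _ Y).
by rewrite -[X in _ <-> bounded_in P _ (f @` X)]range_set_val image_comp.
Qed.

(** Up to enlargement, entourages of [Y] are preimages of those of [X], so sections at [y] and
    traces on [range f] of neighbourhoods of [f y] can be shrunk into one another. *)
Lemma locally_bounded_induced (P : selection_property) (Y X : uniformType)
    (f : Y -> X) : induced_by Y X f ->
  locally_bounded P Y <->
  forall y : Y, exists2 N, nbhs (f y) N & bounded_in P X (range f `&` N).
Proof.
move=> fi; split=> bY y.
  have [U [[entU _] bU]] := bY y.
  have := entU; rewrite fi => -[V entV VU].
  exists (xsection V (f y)); first exact: nbhs_entourage.
  have U0 : xsection U y !=set0.
    by exists y; apply/xsectionP; exact: entourage_refl.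
  move/(bounded_set_type _ _ _ _ _ fi U0) : bU; apply: sub_bounded_in.
  by move=> _ [[z _ <-] /xsectionP Vz]; exists z => //; apply/xsectionP/VU.
have [N /nbhsP[V entV VN] bN] := bY y.
have /sym_entourageI symU : entourage (pair_preimage f V).
  by rewrite fi; exists V.
eexists; split; first exact: symU.
apply/(bounded_set_type _ _ _ _ _ fi).
  by exists y; apply/xsectionP; apply: entourage_refl; case: symU.
apply: sub_bounded_in bN => _ [z /xsectionP[Vz _] <-].
by split; [exists z | apply: VN; apply/xsectionP].
Qed.

(** Induction on the cardinality of [D]: removing one index leaves two bounded pieces, on the
    intersection of their neighbourhoods. *)
Lemma bounded_in_bigcup (P : selection_property) (X : uniformType) (x : X)
    (I : Type) (A : I -> set X) (D : set I) : finite_set D ->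
  (forall i, exists2 N, nbhs x N & bounded_in P X (A i `&` N)) ->
  exists2 N, nbhs x N & bounded_in P X ((\bigcup_(i in D) A i) `&` N).
Proof.
move=> [n + bA]; elim: n D => [D|n IH D /eq_cardSP[i Di /IH[N xN bN]]].
  rewrite II0 card_eq0 => /eqP ->; exists setT; first exact: filterT.
  by rewrite bigcup_set0 set0I; exact: bounded_in0.
have [M xM bM] := bA i; exists (M `&` N); first exact: filterI.
apply: sub_bounded_in (bounded_inU _ _ _ _ bM bN) => y [[j Dj Ajy] [My Ny]].
have [ji|ji] := pselect (j = i); first by left; rewrite -ji.
by right; split=> //; exists j.
Qed.

Theorem theorem4p6 (P : selection_property) (X : uniformType)
    (sepX : separated_uniformity X) (Lambda : Type) (A : Lambda -> set X)
    (lfA : locally_finite A) (clA : forall a : Lambda, closed (A a))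
    (covA : [set: X] = \bigcup_(a in [set: Lambda]) A a) :
  locally_bounded P X <->
  forall a : Lambda, locally_bounded P (set_type (A a)).
Proof.
(* [X] is treated as a subspace of itself through the identity. *)
have lbX : locally_bounded P X <->
    forall x : X, exists2 N : set X, nbhs x N & bounded_in P X N.
  have idi : induced_by X X idfun.
    apply/seteqP; split=> U; first by exists U => //; case.
    by move=> [V entV VU]; apply: filterS entV => -[x y]; exact: (VU (x, y)).
  apply: iff_trans (locally_bounded_induced P _ _ _ idi) _.
  have eqN N : range idfun `&` N = N :> set X by rewrite image_id setTI.
  split=> bX x; have [N xN bN] := bX x; exists N => //;
    by move: bN; rewrite eqN.
have lbA a : locally_bounded P (set_type (A a)) <->
    forall x : X, A a x ->
    exists2 N : set X, nbhs x N & bounded_in P X (A a `&` N).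
  have iA := set_type_induced X (A a).
  apply: iff_trans (locally_bounded_induced P _ _ _ iA) _.
  rewrite range_set_val.
  split=> bA x; first by move=> /mem_set Ax; exact: (bA (SigSub Ax)).
  by apply: bA; exact: set_valP.
rewrite lbX; split=> [bX a|bA x].
  apply/lbA => x _; have [N xN bN] := bX x; exists N => //.
  by apply: sub_bounded_in bN => y [].
have bx a : exists2 N : set X, nbhs x N & bounded_in P X (A a `&` N).
  have [Ax|Ax] := pselect (A a x); first exact: (lbA a).1.
  (* Closedness of [A a] makes its complement a neighbourhood of [x], with empty trace on [A a]. *)
  exists (~` A a); last by rewrite setICr; exact: bounded_in0.
  by apply: open_nbhs_nbhs; split=> //; exact: closed_openC.
have [V [xV finV]] := lfA x.
have [N xN bN] := bounded_in_bigcup _ _ _ _ _ _ finV bx.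
exists (V `&` N); first exact: filterI.
(* Any [A a] containing a point [y] of [V] meets [V], so its index is among the finitely many in the
   union. *)
apply: sub_bounded_in bN => y [Vy Ny]; split=> //.
have : [set: X] y by []; rewrite covA => -[a _ Ay].
by exists a => //; exists y.
Qed.
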